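(* Let $T$ be an almost symmetric numerical semigroup with even Frobenius number. Then $S:=\frac{T}{2}$ is almost symmetric and its type is exactly the number of even pseudo-Frobenius numbers of $T$.
   Context: $\mathbb{N}$ denotes the non-negative integers. A numerical semigroup $S$ is a submonoid of $\mathbb{N}$ with $\mathbb{N}\setminus S$ finite; $f(S)=\max(\mathbb{Z}\setminus S)$ is its Frobenius number (so $f(\mathbb{N})=-1$). The set of pseudo-Frobenius numbers is $\mathrm{PF}(S)=\{x\in\mathbb{Z}\setminus S \mid x+s\in S \text{ for any } s\in S\setminus\{0\}\}$, and the type of $S$ is $|\mathrm{PF}(S)|$. $\mathrm{L}(S)=\{x\in\mathbb{Z} \mid x\notin S,\ f(S)-x\notin S\}$; $S$ is almost symmetric if $\mathrm{L}(S)\subseteq \mathrm{PF}(S)$. $\frac{T}{2}=\{s\in\mathbb{N}\mid 2s\in T\}$. *)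

(* Defs.v *)
From mathcomp Require Import all_boot all_order all_algebra finmap.
From mathcomp Require Import all_classical.
From mathcomp Require Import zify.

Set Implicit Arguments.
Unset Strict Implicit.
Unset Printing Implicit Defensive.

Import Order.TTheory GRing.Theory Num.Theory.

Local Open Scope classical_set_scope.
Local Open Scope ring_scope.

Definition numerical_semigroup (S : set nat) : Prop :=
  [/\ S 0%N,
      forall a b : nat, S a -> S b -> S (a + b)%N
    & finite_set (~` S)].

(* S seen as a subset of Z. *)
Definition zset (S : set nat) : set int := [set n%:Z | n in S].

(* max (Z \ S); the default value 0 is irrelevant for numerical semigroups,
   see frobeniusP. *)
Definition frobenius (S : set nat) : int :=
  xget 0 [set f : int | ~ zset S f /\ forall x : int, ~ zset S x -> x <= f].

Definition PF (S : set nat) : set int :=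
  [set x : int | ~ zset S x /\
                 forall s : nat, S s -> s <> 0%N -> zset S (x + s%:Z)].

(* The cardinality of PF S, which is finite by finite_PF (fset_set would send
   an infinite set to the empty one). *)
Definition semigroup_type (S : set nat) : nat := #|` fset_set (PF S)|%fset.

Definition L (S : set nat) : set int :=
  [set x : int | ~ zset S x /\ ~ zset S (frobenius S - x)].

Definition almost_symmetric (S : set nat) : Prop := L S `<=` PF S.

(* T / 2 *)
Definition half_semigroup (T : set nat) : set nat := [set s : nat | T (2 * s)%N].

Definition even_PF (T : set nat) : set int :=
  [set x : int | PF T x /\ (2 %| x)%Z].

Lemma zset_nat (S : set nat) (n : nat) : zset S n%:Z <-> S n.
Proof. by split=> [[m Sm [<-]]|Sn] //; exists n. Qed.

Lemma gaps_bounded (S : set nat) : numerical_semigroup S ->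
  exists N : nat, forall n : nat, (N <= n)%N -> S n.
Proof.
case=> _ _ /finite_seqP[s sE]; exists (\max_(i <- s) i).+1 => n ltn.
apply: contrapT => nSn; have : n \in s by have : (~` S) n by []; rewrite sE.
by move=> /(@leq_bigmax_seq _ s xpredT id n)/(_ isT); lia.
Qed.

Lemma frobeniusP (S : set nat) : numerical_semigroup S ->
  ~ zset S (frobenius S) /\
  forall x : int, ~ zset S x -> x <= frobenius S.
Proof.
move=> numS; have [N SN] := gaps_bounded numS.
apply: (@xgetPex _ 0
  [set f : int | ~ zset S f /\ forall x : int, ~ zset S x -> x <= f]).
pose p n := `[< ~ zset S (n%:Z - 1) >].
have p0 : exists n, p n by exists 0%N; apply/asboolP => -[m _]; lia.
have pN n : p n -> (n <= N)%N.
  move/asboolP => nS; rewrite leqNgt; apply/negP => ltNn; apply: nS.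
  by exists n.-1; [apply: SN; lia|lia].
case: (ex_maxnP p0 pN) => f /asboolP fS fmax; exists (f%:Z - 1); split=> // x xS.
have [|x0] := ltrP x 0; first by lia.
have : (`|x|.+1 <= f)%N; last by lia.
apply/fmax/asboolP; have -> : `|x|.+1%:Z - 1 = x by lia.
exact: xS.
Qed.

Lemma finite_PF (S : set nat) : numerical_semigroup S -> finite_set (PF S).
Proof.
move=> numS; have [N SN] := gaps_bounded numS.
apply: (@sub_finite_set _ _ [set n%:Z - N.+1%:Z | n in `I_(N.+1 + N)%N]).
  move=> x [xS xPF].
  have xN : x < N%:Z.
    rewrite ltNge; apply/negP => Nx; apply: xS.
    by exists `|x|%N; [apply: SN; lia|lia].
  have [|//|m _ mE] := xPF N.+1; first by apply: SN; lia.
  by exists m => /=; lia.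
exact/finite_image/finite_II.
Qed.

Lemma numerical_half_semigroup (T : set nat) :
  numerical_semigroup T -> numerical_semigroup (half_semigroup T).
Proof.
move=> numT; have [N TN] := gaps_bounded numT; case: (numT) => T0 TD _.
split=> [|a b Ta Tb|]; rewrite /half_semigroup /= ?muln0 //.
  by rewrite mulnDr; apply: TD.
apply: (@sub_finite_set _ _ `I_N); last exact: finite_II.
move=> n /= nT; rewrite ltnNge; apply/negP => Nn; apply: nT; apply: TN; lia.
Qed.

(* Main.v *)
Require Import Defs.
From mathcomp Require Import all_boot all_order all_algebra finmap.
From mathcomp Require Import all_classical.
From mathcomp Require Import zify.

(** Membership of [x] in [T/2] is membership of [2x] in [T], also for negative
    [x], so [f(T/2) = f(T)/2] and [x] lies in [L(T/2)] iff [2x] lies in [L(T)].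
    If [2x] is pseudo-Frobenius for [T], then [x] is so for [T/2].  Conversely,
    let [x] be in [PF(T/2)].  If [f(T) - 2x] is not in [T], then [2x] is in
    [L(T)], hence in [PF(T)].  Otherwise [f(T)/2 - x] is in [T/2], and it is [0],
    since else [f(T)/2] would be in [T/2]; so [2x = f(T)], again in [PF(T)].
    Thus doubling is a bijection from [PF(T/2)] to the even part of [PF(T)]. *)

Import Order.TTheory GRing.Theory Num.Theory.

Local Open Scope classical_set_scope.
Local Open Scope ring_scope.

Lemma zset_half (T : set nat) (x : int) :
  zset (half_semigroup T) x <-> zset T (2 * x).
Proof.
split=> [[n Tn <-]|[n Tn nE]]; first by exists (2 * n)%N => //; lia.
(* As [2 * x] equals the natural number [n], [x] is nonnegative. *)
have nE2 : n = (2 * `|x|)%N by lia.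
exists `|x|%N; last by lia.
by rewrite /half_semigroup /= -nE2.
Qed.

(** Adding a positive [s] goes past the largest integer outside [T]. *)
Lemma frobenius_PF (T : set nat) :
  numerical_semigroup T -> PF T (frobenius T).
Proof.
move=> /frobeniusP[fT fmax]; split=> // s _ s0.
by apply: contrapT => /fmax; lia.
Qed.

Lemma frobenius_half (T : set nat) :
  numerical_semigroup T -> (2 %| frobenius T)%Z ->
  frobenius T = 2 * frobenius (half_semigroup T).
Proof.
move=> numT /dvdzP[g gE].
have [fT fmax] := frobeniusP numT.
have [hT hmax] := frobeniusP (numerical_half_semigroup numT).
(* Maximality is used twice: for [T/2] it bounds [g] above by the Frobenius number of [T/2], and for
   [T] it gives the reverse bound. *)
have gT : ~ zset (half_semigroup T) g by rewrite zset_half mulrC -gE.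
have := hmax _ gT.
have /fmax : ~ zset T (2 * frobenius (half_semigroup T)) by rewrite -zset_half.
by lia.
Qed.

Lemma PF_double (T : set nat) (x : int) :
  PF T (2 * x) -> PF (half_semigroup T) x.
Proof.
case=> xT xPF; split=> [|s Ts s0]; first by rewrite zset_half.
rewrite zset_half mulrDr; apply: (xPF (2 * s)%N) => //; lia.
Qed.

Lemma L_half (T : set nat) (x : int) :
  numerical_semigroup T -> (2 %| frobenius T)%Z ->
  L (half_semigroup T) x <-> L T (2 * x).
Proof.
by move=> numT f2; rewrite /L /= !zset_half mulrBr -frobenius_half.
Qed.

Lemma PF_half (T : set nat) (x : int) :
  numerical_semigroup T -> almost_symmetric T -> (2 %| frobenius T)%Z ->
  PF (half_semigroup T) x <-> PF T (2 * x).
Proof.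
move=> numT asT f2; split; last exact: PF_double.
case=> xT xPF; have [hT _] := frobeniusP (numerical_half_semigroup numT).
case: (pselect (L T (2 * x))) => [/asT //|nL].
have [s Ts sE] : zset (half_semigroup T) (frobenius (half_semigroup T) - x).
  by apply: contrapT => nh; apply: nL; rewrite -L_half.
have [s0|s0] := eqVneq s 0%N.
  suff -> : 2 * x = frobenius T by exact: frobenius_PF.
  by rewrite frobenius_half //; lia.
case: hT; have -> : frobenius (half_semigroup T) = x + s%:Z by lia.
by apply: xPF => //; apply/eqP.
Qed.

Lemma even_PF_half (T : set nat) :
  numerical_semigroup T -> almost_symmetric T -> (2 %| frobenius T)%Z ->
  even_PF T = [set 2 * x | x in PF (half_semigroup T)].
Proof.
move=> numT asT f2; apply/seteqP; split=> [y [yPF /dvdzP[x yE]]|_ [x xPF <-]].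
  by exists x; rewrite ?PF_half // mulrC -yE.
by split; [rewrite -PF_half | rewrite dvdz_mulr].
Qed.

Theorem theorem4p2 (T : set nat) :
  numerical_semigroup T ->
  almost_symmetric T ->
  (2 %| frobenius T)%Z ->
  [/\ numerical_semigroup (half_semigroup T),
      almost_symmetric (half_semigroup T)
    & semigroup_type (half_semigroup T) = #|` fset_set (even_PF T)|%fset].
Proof.
move=> numT asT f2; have numH := numerical_half_semigroup numT.
split=> // [x|].
  (* Double into [L T], pass to [PF T], then halve. *)
  by rewrite L_half // => /asT/PF_double.
rewrite even_PF_half // fset_set_image; last exact: finite_PF.
by rewrite card_imfset //; apply: mulfI.
Qed.
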